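(* Let $k\ge 2$ be an integer. The communication complexity of constructing a $+k$-spanner of an unweighted undirected distributed graph on $n$ vertices with edges observed at $s$ sites in the blackboard model, with or without duplication, is $\tilde{O}(s+n\sqrt{n+s})$.
   Context: Distributed graph: there are $s$ sites $S_1,\dots,S_s$; all know the common vertex set $V$, $|V|=n$, and site $S_i$ holds a subset $E_i\subseteq E$ of the edges of an undirected graph $G=(V,E)$, where $E=\bigcup_{i=1}^s E_i$. In the setting without duplication the sets $E_i$ are pairwise disjoint; in the duplication setting they may intersect. Blackboard model: sites communicate by writing messages on a shared blackboard (a broadcast channel) visible to all sites and to a coordinator, who must output the result. The communication cost of a protocol is the total number of bits communicated; the communication complexity of a problem is the least communication cost of a (randomized, with success probability $1-o(1)$) protocol solving it. Spanner: a $+k$-spanner of $G$ is a subgraph $H=(V,E')$, $E'\subseteq E$, with $d_H(u,v)\le d_G(u,v)+k$ for all $u,v\in V$, where $d$ denotes shortest-path distance. $\tilde{O}(f)$ denotes $f$ times a polylogarithmic factor (in $n$ and $s$). *)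

(* Defs.v *)
From HB Require Import structures.
From mathcomp Require Import all_boot all_order all_algebra.
From mathcomp Require Import all_classical all_reals all_analysis.
Set Implicit Arguments.
Unset Strict Implicit.
Unset Printing Implicit Defensive.
Import Order.TTheory GRing.Theory Num.Theory.
Import numFieldNormedType.Exports.
Local Open Scope classical_set_scope.
Local Open Scope ring_scope.

(* A blackboard protocol between s sites, site i holding an input in X and a
   private random string in W.  The tree position is the content of the
   blackboard, so the next writer, the function giving the bit it writes, and
   the decision to stop depend only on what has been written.  At a leaf the
   coordinator, who has no input, computes the result from the blackboard and
   its own random string. *)
Inductive protocol (s : nat) (X Y W : Type) : Type :=
| Output of (W -> Y)
| Write of 'I_s & (X -> W -> bool) & (bool -> protocol s X Y W).

Section Protocol.
Variables (s : nat) (X : finType) (Y : Type) (r : nat).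

(* [None] is the coordinator. *)
Definition coins := {ffun option 'I_s -> r.-tuple bool}.

Fixpoint blackboard (p : protocol s X Y (r.-tuple bool))
    (x : {ffun 'I_s -> X}) (w : coins) : seq bool :=
  match p with
  | Output _ => [::]
  | Write i msg next =>
      let b := msg (x i) (w (Some i)) in b :: blackboard (next b) x w
  end.

Fixpoint result (p : protocol s X Y (r.-tuple bool))
    (x : {ffun 'I_s -> X}) (w : coins) : Y :=
  match p with
  | Output out => out (w None)
  | Write i msg next => result (next (msg (x i) (w (Some i)))) x w
  end.

Definition cost (valid : pred {ffun 'I_s -> X})
    (p : protocol s X Y (r.-tuple bool)) : nat :=
  (\max_(x | valid x) \max_(w : coins) size (blackboard p x w))%N.

(* The coins are independent and fair. *)
Definition success_prob (R : realType) (correct : {ffun 'I_s -> X} -> Y -> Prop)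
    (p : protocol s X Y (r.-tuple bool)) (x : {ffun 'I_s -> X}) : R :=
  #|[set w : coins | `[< correct x (result p x w) >]]%SET|%:R / #|{: coins}|%:R.

End Protocol.

(* The infimum is +oo if no protocol meets the success requirement; otherwise
   it is a minimum, the costs being natural numbers. *)
Definition comm_complexity (R : realType) (s : nat) (X : finType) (Y : Type)
    (valid : pred {ffun 'I_s -> X}) (correct : {ffun 'I_s -> X} -> Y -> Prop)
    (eps : R) : \bar R :=
  ereal_inf [set c : \bar R |
    exists (r : nat) (p : protocol s X Y (r.-tuple bool)),
      (forall x, valid x -> 1 - eps <= success_prob R correct p x) /\
      c = (cost valid p)%:R%:E].

(* An undirected edge {u, v} is the two-element set [set u; v]. *)
Definition edges (n : nat) := {set {set 'I_n}}.

Definition adj (n : nat) (E : edges n) : rel 'I_n :=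
  fun u v => [set u; v]%SET \in E.

(* +oo if u and v are not connected. *)
Definition dist (R : realType) (n : nat) (E : edges n) (u v : 'I_n) : \bar R :=
  ereal_inf [set l : \bar R |
    exists q : seq 'I_n,
      [/\ path (adj E) u q, last u q = v & l = (size q)%:R%:E]].

Definition is_spanner (R : realType) (k n : nat) (E E' : edges n) : Prop :=
  E' \subset E /\
  forall u v, (dist R E' u v <= dist R E u v + k%:R%:E)%E.

Definition distributed_graph (dup : bool) (n s : nat) :
    pred {ffun 'I_s -> edges n} :=
  fun x => [forall i, forall e in x i, #|e| == 2%N] &&
    (dup || [forall i, forall j, (i != j) ==> [disjoint x i & x j]]).

Definition spanner_problem (R : realType) (k n s : nat)
    (x : {ffun 'I_s -> edges n}) (E' : edges n) : Prop :=
  is_spanner R k (\bigcup_(i < s) x i)%SET E'.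

Definition spanner_complexity (R : realType) (k : nat) (dup : bool)
    (eps : R) (n s : nat) : \bar R :=
  comm_complexity (distributed_graph dup (n := n) (s := s))
    (@spanner_problem R k n s) eps.

(* The shift by 2 keeps the logarithm positive for all n and s. *)
Definition soft_O (R : realType) (f : nat -> nat -> \bar R)
    (g : nat -> nat -> R) : Prop :=
  exists (C : R) (c : nat), forall n s : nat,
    (f n s <= (C * g n s * ln (n + s + 2)%N%:R ^+ c)%:E)%E.

(* Main.v *)
Require Import Defs.
From HB Require Import structures.
From mathcomp Require Import all_boot all_order all_algebra.
From mathcomp Require Import all_classical all_reals all_analysis.
From mathcomp Require Import zify ring lra.
From mathcomp Require Import fintype finset.
Import Order.TTheory GRing.Theory Num.Theory.
Import numFieldNormedType.Exports.

(* A deterministic protocol does it, for the threshold d = sqrt(n + s).  First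
   every site in turn writes those of its edges that have an endpoint with fewer
   than d edges on the board: s + nd messages, after which an edge of G missing
   from the board joins two vertices of the set Z of vertices of degree at least
   d on the board.  Everyone can then compute a set C of (n / d) log n centers
   meeting the neighbourhood of each vertex of Z.  Next, breadth-first searches
   from all centers are run in parallel.  A search has to poll the sites only at
   the levels that contain a vertex of Z; as levels at distance at least 3 have
   disjoint neighbourhoods, there are at most 3n / d of these.  Hence 3n / d
   polls of s messages are enough, and the edges written are paid for by the
   |C| n pairs (center, vertex) whose distance on the board becomes exact.  In
   the end a shortest path missing from the board passes through some z in Z,
   and the detour through a center adjacent to z costs 2.  Neither phase uses
   that the edge sets of the sites are disjoint. *)

Set Implicit Arguments.
Unset Strict Implicit.
Unset Printing Implicit Defensive.

Local Open Scope nat_scope.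

(** * Graph distance as a natural number *)

Section Hops.
Variable n : nat.
Implicit Types (E H G : edges n) (u v w : 'I_n) (q : seq 'I_n).

Lemma adj_sym E : symmetric (adj E).
Proof. by move=> u v; rewrite /adj setUC. Qed.

Lemma adj_sub E G u v : E \subset G -> adj E u v -> adj G u v.
Proof. by move=> /subsetP; apply. Qed.

(* Graph distance capped at [n.+2], which stands for infinity: a distance is
   below [n], so two more hops still stay below the cap. *)
Definition hops E u v : nat :=
  find (fun l => `[< exists q,
                     [/\ path (adj E) u q, last u q = v & size q = l] >])
       (iota 0 n.+2).

Lemma hops_le_cap E u v : hops E u v <= n.+2.
Proof. by rewrite -[leqRHS](size_iota 0); apply: find_size. Qed.

Lemma hops_le_size E u q : path (adj E) u q -> hops E u (last u q) <= size q.
Proof.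
move=> uq; have [ltq|/(leq_trans (hops_le_cap _ _ _))//] := ltnP (size q) n.+2.
rewrite leqNgt; apply/negP => lt_q; have := before_find 0 lt_q.
by rewrite nth_iota// add0n => /negP; apply; apply/asboolP; exists q.
Qed.

Lemma hops_path E u v : hops E u v < n.+2 ->
  exists q, [/\ path (adj E) u q, last u q = v & size q = hops E u v].
Proof.
move=> lt_uv; have := lt_uv; rewrite -[X in _ < X](size_iota 0) -has_find.
by move=> /(nth_find 0); rewrite -/(hops E u v) nth_iota// add0n => /asboolP.
Qed.

Lemma hops_refl E u : hops E u u = 0.
Proof. by apply/eqP; rewrite -leqn0; apply: (@hops_le_size E u [::]). Qed.

Lemma hops0_eq E u v : hops E u v = 0 -> u = v.
Proof.
move=> uv0; have [|q [_ lq]] := @hops_path E u v; first by rewrite uv0.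
by rewrite uv0 => /eqP; rewrite size_eq0 => /eqP q0; rewrite -lq q0.
Qed.

Lemma hops_adj E u v : adj E u v -> hops E u v <= 1.
Proof. by move=> uv; apply: (@hops_le_size E u [:: v]); rewrite /= uv. Qed.

Lemma hops_sub E G u v : E \subset G -> hops G u v <= hops E u v.
Proof.
move=> sEG; have [/hops_path[q [uq <- <-]]|] := ltnP (hops E u v) n.+2.
  by apply/hops_le_size; apply: sub_path uq => x y; apply: adj_sub.
exact/leq_trans/hops_le_cap.
Qed.

Lemma hops_triangle E w u v : hops E u v <= hops E u w + hops E w v.
Proof.
have [/hops_path[q [uq <- <-]]|] := ltnP (hops E u w) n.+2; last first.
  by move=> /(leq_trans (hops_le_cap _ u v)) /leq_trans; apply; apply: leq_addr.
have [/hops_path[p [wp <- <-]]|] := ltnP (hops E (last u q) v) n.+2; last first.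
  by move=> /(leq_trans (hops_le_cap _ u v)) /leq_trans; apply; apply: leq_addl.
by rewrite -last_cat -size_cat hops_le_size// cat_path uq.
Qed.

Lemma hops_sym E u v : hops E u v = hops E v u.
Proof.
suff le_uv x y : hops E x y <= hops E y x by apply/eqP; rewrite eqn_leq !le_uv.
have [/hops_path[q [yq <- <-]]|] := ltnP (hops E y x) n.+2; last first.
  exact/leq_trans/hops_le_cap.
have := @hops_le_size E (last y q) (rev (belast y q)).
rewrite rev_path (eq_path (e' := adj E)); last by move=> a b; apply: adj_sym.
move=> /(_ yq); rewrite size_rev size_belast.
suff -> : last (last y q) (rev (belast y q)) = y by [].
by case: q {yq} => //= z q; rewrite rev_cons last_rcons.
Qed.

(** The second hypothesis rules out the cap, a value that no walk realizes. *)
Lemma hops_pred E u v l : hops E u v = l.+1 -> l.+1 < n.+2 ->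
  exists w, adj E w v /\ hops E u w = l.
Proof.
move=> uvl ltl; have [|q [uq lq]] := @hops_path E u v; first by rewrite uvl.
rewrite uvl; case/lastP: q uq lq => // q x.
rewrite rcons_path last_rcons size_rcons => /andP[uq qx] xv [sq].
rewrite {}xv in qx; exists (last u q); split => //.
apply/eqP; rewrite eqn_leq -{1}sq hops_le_size//= -ltnS -uvl.
apply: leq_trans (hops_triangle E (last u q) u v) _.
by rewrite -addn1 leq_add2l hops_adj.
Qed.

End Hops.

(** * Small hitting sets by greedy choice *)

Section Hitting.
Variables (I T : finType) (N : I -> {set T}) (Z : {set I}) (d : nat).
Hypotheses (d_gt0 : 0 < d) (dN : forall z, z \in Z -> d <= #|N z|).

Definition missed (C : {set T}) := [set z in Z | [disjoint N z & C]].

(** Averaging: each missed set contains at least [d] of the [#|T|] points, so some point hits a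
    fraction [d / #|T|] of the missed sets. Clearing denominators keeps everything in [nat]. *)
Lemma greedy_step (C : {set T}) z0 : z0 \in Z ->
  exists y, #|missed (y |: C)| * #|T| <= #|missed C| * (#|T| - d).
Proof.
move=> z0Z; have T_gt0 : 0 < #|T|.
  by rewrite (leq_trans d_gt0)// (leq_trans (dN z0Z)) ?max_card.
apply/existsP; apply: contraT; rewrite negb_exists => /forallP noy.
pose hit y := [set z in missed C | y \in N z].
have hit_missed y : #|missed (y |: C)| = #|missed C| - #|hit y|.
  rewrite -cardsDS; last by apply/subsetP => z; rewrite inE => /andP[].
  apply: eq_card => z; rewrite !inE -setI_eq0 setIUr setU_eq0 !setI_eq0.
  rewrite [[disjoint _ & [set y]]]disjoint_sym disjoints1.
  by case: (z \in Z); case: (y \in N z) => //=; case: [disjoint _ & _].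
have hit_le y : #|hit y| <= #|missed C|.
  by apply/subset_leq_card/subsetP => z; rewrite inE => /andP[].
have hits : #|missed C| * d <= \sum_y #|hit y|.
  under eq_bigr do rewrite -sum1_card.
  rewrite (exchange_big_dep (mem (missed C))) => /=; last first.
    by move=> y z _; rewrite inE => /andP[].
  rewrite -sum_nat_const; apply: leq_sum => z zC; have zZ : z \in Z.
    by move: zC; rewrite inE => /andP[].
  rewrite sum1_card (leq_trans (dN zZ))//.
  apply/subset_leq_card/subsetP => y yz; have : z \in hit y by rewrite inE zC.
  by [].
have : \sum_(y : T) (#|missed C| * (#|T| - d)).+1 <= \sum_y #|missed (y |: C)| * #|T|.
  by apply: leq_sum => y _; rewrite ltnNge; apply: noy.
rewrite sum_nat_const -big_distrl /= mulnC leq_pmul2r// => missed_big.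
have : \sum_y #|missed (y |: C)| + \sum_y #|hit y| = #|T| * #|missed C|.
  rewrite -big_split /= -sum_nat_const.
  by apply: eq_bigr => y _; rewrite hit_missed subnK.
move: missed_big; rewrite mulnBr [#|T| * _]mulnC => ltM eqM.
suff : #|missed C| * #|T| < #|missed C| * #|T| by rewrite ltnn.
rewrite -[ltnRHS]eqM; apply: leq_trans (leq_add ltM hits).
by rewrite addSn ltnS addnC -leq_subLR.
Qed.

Lemma greedy z0 m : z0 \in Z -> exists C : {set T},
  #|C| <= m /\ #|missed C| * #|T| ^ m <= #|Z| * (#|T| - d) ^ m.
Proof.
move=> z0Z; elim: m => [|m [C [Cm IH]]].
  exists set0; rewrite cards0 !expn0 !muln1; split => //.
  by apply/subset_leq_card/subsetP => z; rewrite inE => /andP[].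
have [y yC] := greedy_step C z0Z; exists (y |: C); split.
  by rewrite cardsU1 -[m.+1]add1n; apply: leq_add => //; case: (_ \notin _).
rewrite !expnSr !mulnA mulnAC (leq_trans (leq_mul yC (leqnn _)))//.
by rewrite mulnAC leq_mul.
Qed.

(** Bernoulli's inequality for [(1 + b / a) ^ q], multiplied by [a ^ q.+1]. *)
Lemma expn_bernoulli a b q : (a + q * b) * a ^ q <= a * (a + b) ^ q.
Proof.
elim: q => [|q IH]; first by rewrite mul0n addn0.
rewrite !expnS; apply: (@leq_trans ((a + b) * ((a + q * b) * a ^ q))).
  by rewrite !mulnA leq_mul2r; apply/orP; right; nia.
by rewrite [leqRHS]mulnCA leq_mul2l IH orbT.
Qed.

(** Every [q] greedy steps at least halve the number of missed sets, and [L] halvings leave less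
    than one. *)
Lemma hitting_set q L : #|T| <= q * d -> #|Z| < 2 ^ L ->
  exists C : {set T}, #|C| <= q * L /\
    forall z, z \in Z -> ~~ [disjoint N z & C].
Proof.
move=> Tqd ZL; have [->|[z0 z0Z]] := set_0Vmem Z.
  by exists set0; rewrite cards0; split=> // z; rewrite inE.
have dT : d <= #|T| by rewrite (leq_trans (dN z0Z)) ?max_card.
have [C [CqL hC]] := greedy (q * L) z0Z; exists C; split => // z zZ.
apply/negP => zC.
have missed_gt0 : 0 < #|missed C| by apply/card_gt0P; exists z; rewrite inE zZ.
(* With [a = #|T| - d], Bernoulli gives the factor [a + q * d], which is at least [2 * a] because
   [a <= #|T| <= q * d]. *)
have double : 2 * (#|T| - d) ^ q <= #|T| ^ q.
  set a := #|T| - d; have Ta : #|T| = a + d by rewrite subnK.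
  have [->|a_gt0] := posnP a; first by rewrite exp0n; nia.
  have := expn_bernoulli a d q; rewrite -Ta => hb.
  rewrite -(leq_pmul2l a_gt0); apply: leq_trans hb.
  by rewrite mulnA leq_mul2r; apply/orP; right; lia.
have : #|missed C| * #|T| ^ (q * L) * 2 ^ L < 2 ^ L * #|T| ^ (q * L).
  apply: leq_ltn_trans (leq_mul hC (leqnn _)) _.
  rewrite -mulnA !expnM -expnMn [_ * 2]mulnC.
  apply: (@leq_ltn_trans (#|Z| * (#|T| ^ q) ^ L)).
    rewrite leq_mul2l leq_exp2r ?double ?orbT//; case: L ZL {CqL hC} => //.
    by rewrite expn0 ltnS leqn0 cards_eq0 => /eqP Z0; rewrite Z0 inE in z0Z.
  by rewrite ltn_pmul2r// !expn_gt0; lia.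
rewrite ltnNge => /negP; apply.
by rewrite -mulnA [X in _ <= _ * X]mulnC leq_pmull.
Qed.

End Hitting.

(** * Exact distances from centers yield a spanner *)

Section Spanner.
Variables (n : nat) (G H : edges n) (Z C : {set 'I_n}).
Hypotheses (sHG : H \subset G)
  (known : forall u v, adj G u v -> u \notin Z -> adj H u v).

(** Cut the walk at its first vertex in [Z]: all edges before it start outside [Z], hence are
    known. *)
Lemma walk_known_or_through u q : path (adj G) u q ->
  path (adj H) u q \/
  exists2 w, w \in Z & hops G u w + hops G w (last u q) <= size q.
Proof.
elim: q u => [|x q IH] u /=; first by left.
case/andP=> ux xq; have [uZ|uZ] := boolP (u \in Z).
  by right; exists u => //; rewrite hops_refl (@hops_le_size _ G u (x :: q))//= ux.
rewrite (known ux uZ); have [->|[w wZ wq]] := IH x xq; [by left|right].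
exists w => //; have := hops_triangle G x u w; have := hops_adj ux; lia.
Qed.

Lemma spanner_of_centers (R : realType) k : 2 <= k ->
  (forall z, z \in Z -> exists2 c, c \in C & adj H z c) ->
  (forall c v, c \in C -> hops H c v = hops G c v) ->
  is_spanner R k G H.
Proof.
move=> k2 dom exact_from; split => // u v.
(* With [k] moved to the left, the infimum on the right can be bounded walk by walk, which also
   covers disconnected vertices. *)
rewrite -leeBlDr//; apply: le_ereal_inf_tmp => _ [q [uq <-{v} ->]].
(* A simple path has length below [n], so two extra hops stay below the cap and [hops] is realized
   by a walk. *)
rewrite leeBlDr//; case: (shortenP uq) => {uq}q' uq' uniq_q' sub_q.
have le_q : size q' <= size q.
  by apply: uniq_leq_size sub_q; case/andP: uniq_q'.
have lt_q' : size q' < n.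
  by have := uniq_leq_size uniq_q' (fun x _ => mem_enum 'I_n x); rewrite size_enum_ord.
suff [p [up lp le_p]] : exists p,
    [/\ path (adj H) u p, last u p = last u q' & size p <= size q' + 2].
  apply: (@le_trans _ _ (size p)%:R%:E); first by apply: ereal_inf_lbound; exists p.
  rewrite -EFinD -natrD lee_fin ler_nat; lia.
have [?|[w wZ wq]] := walk_known_or_through uq'.
  by exists q'; rewrite leq_addr.
have [c cC wc] := dom w wZ.
suff le_uv : hops H u (last u q') <= size q' + 2.
  have [|p [up lp sp]] := @hops_path _ H u (last u q').
    by apply: leq_ltn_trans le_uv _; rewrite addn2 !ltnS.
  by exists p; rewrite sp.
move: (last u q') wq => t wq; have := hops_triangle H c u t.
rewrite (hops_sym H u c) !(exact_from c)// (hops_sym G c u).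
have := hops_triangle G w u c; have := hops_triangle G w c t.
have := hops_adj (adj_sub sHG wc); rewrite (hops_sym G c w) => wc1 ct uc.
move=> /leq_trans -> //; apply: leq_trans (leq_add uc ct) _.
by rewrite [X in _ + X]addnC addnACA leq_add// (@leq_add _ _ 1 1).
Qed.
End Spanner.

(** * Parallel breadth-first searches *)

Section Search.
Variables (n : nat) (Z C : {set 'I_n}).
Implicit Types (G H : edges n) (c u v z : 'I_n).

Definition occupied H c l := [exists z in Z, hops H c z == l].

(** The number of polls that the search from [c] needs before level [l] is settled: only leaving an
    occupied level takes one. *)
Definition rank H c l := \sum_(j < l) occupied H c j.

Lemma rankS H c l : rank H c l.+1 = rank H c l + occupied H c l.
Proof. by rewrite /rank big_ord_recr. Qed.

Lemma leq_rank H c l m : l <= m -> rank H c l <= rank H c m.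
Proof.
move=> /subnKC <-; elim: (m - l) => [|i IH]; first by rewrite addn0.
by rewrite addnS rankS (leq_trans IH) ?leq_addr.
Qed.

Lemma sum_window l a : \sum_(j < l) ((j <= a.+1) && (a <= j.+1)) <= 3.
Proof.
(* The indices counted are those from [a.-1] to [a.+1] that lie below [l]; this form goes through by
   induction on [l]. *)
suff : \sum_(j < l) ((j <= a.+1) && (a <= j.+1)) + minn l a.-1 <= minn l a.+2.
  lia.
elim: l => [|l IH]; first by rewrite big_ord0 !min0n.
rewrite big_ord_recr /=; move: IH; set S := \sum_(_ < l) _.
by case: (leqP l a.+1); case: (leqP a l.+1) => /=; lia.
Qed.

(* Neighbours of occupied levels overlap only if the levels differ by at
   most 2. *)
Lemma rank_bound G c l d :
  (forall z, z \in Z -> d <= #|[set y | adj G z y]|) -> rank G c l * d <= 3 * n.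
Proof.
move=> degZ; rewrite /rank big_distrl /=.
apply: (@leq_trans (\sum_(j < l) \sum_(y : 'I_n)
                      ((j <= (hops G c y).+1) && (hops G c y <= j.+1)))).
  apply: leq_sum => j _; have [/existsP[z /andP[zZ /eqP cz]]|] := boolP (occupied G c j);
    last by rewrite mul0n.
  rewrite mul1n (leq_trans (degZ z zZ))// -sum1dep_card big_mkcond /=.
  apply: leq_sum => y _; case: ifP => // zy.
  have := hops_triangle G z c y; have := hops_triangle G y c z.
  rewrite (hops_sym G y z); move: (hops_adj zy) cz.
  move: (hops G z y) (hops G c z) (hops G c y) => a b e a1 -> h1 h2.
  by rewrite (_ : (j <= e.+1) && (e <= j.+1)); lia.
rewrite exchange_big /= mulnC -[n in n * 3]card_ord -sum_nat_const.
by apply: leq_sum => y _; apply: sum_window.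
Qed.

(* [H0] is the board at the start of round [t], [H] the current one. *)
Definition requested t H0 H u v := (u \in Z) &&
  [exists c in C, (rank H0 c (hops H0 c u) <= t) &&
                  ((hops H0 c u).+1 < hops H c v)].

(** Announcements only remove requests, so a site that has fallen silent stays silent for the rest
    of the round. *)
Lemma requested_sub t H0 H H' u v :
  H \subset H' -> requested t H0 H' u v -> requested t H0 H u v.
Proof.
move=> sHH' /andP[uZ /existsP[c /and3P[cC ct cv]]].
rewrite /requested uZ; apply/existsP; exists c; rewrite cC ct/=.
exact: leq_trans cv (hops_sub _ _ sHH').
Qed.

(** The invariant of the searches after [t] rounds. *)
Definition exact_within G t H := forall c v, c \in C ->
  rank G c (hops G c v) <= t -> hops H c v = hops G c v.

Section Round.
Variables (G H1 : edges n).
Hypothesis known : forall u v, adj G u v -> u \notin Z -> adj H1 u v.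

(** Induction on the level, through a predecessor [u] of [v]. If [u] is in [Z], its level is
    occupied, so the rank grows strictly and the last hypothesis applies; otherwise the edge is
    already known. *)
Lemma exact_extend t H : H1 \subset H -> H \subset G ->
  (forall c u v, c \in C -> adj G u v -> u \in Z ->
     rank G c (hops G c u) < t -> hops H c v <= (hops G c u).+1) ->
  exact_within G t H.
Proof.
move=> sH1H sHG reach c v cC; move el: (hops G c v) => l.
elim: l v el => [|l IH] v el lt.
  by rewrite -(hops0_eq el) hops_refl.
apply/eqP; rewrite eqn_leq -[X in _ && (X <= _)]el hops_sub// andbT.
have [ltl|] := ltnP l.+1 n.+2; last by apply/leq_trans/hops_le_cap.
have [u [uv cu]] := hops_pred el ltl; have [uZ|uZ] := boolP (u \in Z).
  rewrite -cu reach// cu (leq_trans _ lt)// rankS -addn1 leq_add2l lt0b.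
  by apply/existsP; exists u; rewrite uZ cu eqxx.
have := hops_triangle H u c v; rewrite (IH u cu); last first.
  by rewrite (leq_trans _ lt)// leq_rank.
by move=> /leq_trans; apply; rewrite -addn1 leq_add2l hops_adj// (adj_sub sH1H)// known.
Qed.

Lemma exact0 : H1 \subset G -> exact_within G 0 H1.
Proof. by move=> sH1G; apply: exact_extend. Qed.

Section Step.
Variables (t : nat) (H0 : edges n).
Hypotheses (sH1H0 : H1 \subset H0) (sH0G : H0 \subset G) (exH0 : exact_within G t H0).

Lemma rank_exact_le c l : c \in C -> rank G c l <= t -> rank H0 c l <= rank G c l.
Proof.
move=> cC lt; apply: leq_sum => j _; rewrite /occupied.
case: existsP => // -[z /andP[zZ /eqP cz]].
rewrite (_ : [exists _ in _, _])//; apply/existsP; exists z; rewrite zZ -cz.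
have ze : hops H0 c z = hops G c z.
  apply: exH0 => //; rewrite (leq_trans _ lt)// leq_rank//.
  by rewrite (leq_trans (hops_sub _ _ sH0G))// cz ltnW.
by rewrite ze eqxx.
Qed.

(** Beyond rank [t] the board need not be exact, but the rank read off it still exceeds [t]. *)
Lemma rank_exact_ge c l : c \in C -> minn (rank G c l) t.+1 <= rank H0 c l.
Proof.
move=> cC; elim: l => [|l IH]; first by rewrite {1}/rank big_ord0 min0n.
rewrite !rankS; have [lt|lt] := leqP (rank G c l) t; last by lia.
suff : occupied G c l <= occupied H0 c l by lia.
rewrite /occupied; case: existsP => // -[z /andP[zZ /eqP cz]].
rewrite (_ : [exists _ in _, _])//; apply/existsP; exists z.
by rewrite zZ (exH0 cC) cz// eqxx.
Qed.

(** Soundness of the test in [requested], which sites evaluate on the board alone: levels on the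
    board are at least the true ones, and ranks grow with the level. *)
Lemma requested_rank c u : c \in C -> rank H0 c (hops H0 c u) <= t ->
  hops H0 c u = hops G c u /\ rank G c (hops G c u) <= t.
Proof.
move=> cC ut; have := @rank_exact_ge c (hops H0 c u) cC.
have := leq_rank G c (hops_sub c u sH0G) => le_rank geq.
have ltG : rank G c (hops G c u) <= t by lia.
by split => //; apply: exH0.
Qed.

(** Completeness of that test: by [rank_exact_le] every vertex of true rank at most [t] passes it,
    so without requests all edges leaving such vertices of [Z] have been exploited. *)
Lemma exact_step H : H0 \subset H -> H \subset G ->
  (forall u v, adj G u v -> ~~ requested t H0 H u v) -> exact_within G t.+1 H.
Proof.
move=> sH0H sHG done; apply: exact_extend => //.
  exact: fintype.subset_trans sH0H.
move=> c u v cC uv uZ; rewrite ltnS => ut; have cu := exH0 cC ut.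
rewrite leqNgt; apply: contraNN (done u v uv) => cv.
rewrite /requested uZ; apply/existsP; exists c; rewrite cC cu cv andbT/=.
by rewrite (leq_trans (rank_exact_le cC ut)).
Qed.

(** The potential that pays for the edges written during the searches. *)
Definition exact_pairs H :=
  [set p : 'I_n * 'I_n | (p.1 \in C) && (hops H p.1 p.2 == hops G p.1 p.2)].

Lemma requested_progress H u v : H0 \subset H -> H \subset G -> adj G u v ->
  requested t H0 H u v ->
  #|exact_pairs H| < #|exact_pairs ([set u; v] |: H)|.
Proof.
move=> sH0H sHG uv /andP[uZ /existsP[c /and3P[cC /(requested_rank cC)[cu ut] cv]]].
set H' := _ |: H; have sHH' : H \subset H' by apply: subsetUr.
have sH'G : H' \subset G by rewrite subUset sub1set; apply/andP.
apply/proper_card/properP; split.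
  apply/subsetP => -[a b]; rewrite !inE /= => /andP[-> /eqP ab] /=.
  by rewrite eqn_leq [X in _ && X]hops_sub// andbT -ab hops_sub.
(* Were [v] no farther than [u], its distance would be exact in [H0] already, and nothing would be
   requested. So the new edge makes the pair [(c, v)] exact. *)
have cvG : hops G c u < hops G c v.
  rewrite ltnNge; apply/negP => vu.
  have ev := exH0 cC (leq_trans (leq_rank G c vu) ut).
  by have := hops_sub c v sH0H; rewrite ev; lia.
have cvH' : hops H' c v <= (hops G c u).+1.
  have uvH' : adj H' u v by rewrite /adj setU11.
  have := hops_triangle H' u c v; have := hops_adj uvH'.
  have := hops_sub c u (fintype.subset_trans sH0H sHH'); rewrite cu; lia.
exists (c, v); rewrite !inE /= cC/=.
  by rewrite eqn_leq [X in _ && X]hops_sub// andbT (leq_trans cvH').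
have := hops_triangle G u c v; have := hops_adj uv; lia.
Qed.

End Step.
End Round.
End Search.

(** * Writing numbers and optional values bit by bit *)

Section Messages.
Variables (s : nat) (X : finType) (Y : Type) (r : nat).
Local Notation protocol := (protocol s X Y (r.-tuple bool)).

Implicit Types x : {ffun 'I_s -> X}.

(** Demanding this for all coins is what makes error probability 0 available at the end. *)
Definition achieves (p : protocol) x (Q : Y -> Prop) (c : nat) :=
  forall w, Q (result p x w) /\ size (blackboard p x w) <= c.

Lemma achieves_leq p x Q c c' : c <= c' -> achieves p x Q c -> achieves p x Q c'.
Proof. by move=> cc' pQ w; have [? /leq_trans] := pQ w; split; auto. Qed.

Fixpoint write_nat (K : nat) (i : 'I_s) (f : X -> nat) (next : nat -> protocol) :=
  if K is K'.+1 then
    Write i (fun a _ => odd (f a)) (fun b =>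
      write_nat K' i (fun a => (f a)./2) (fun m => next (b + m.*2)))
  else next 0.

Lemma achieves_write_nat K i f next x Q c : f (x i) < 2 ^ K ->
  achieves (next (f (x i))) x Q c -> achieves (write_nat K i f next) x Q (K + c).
Proof.
elim: K f next => [|K IH] f next /=.
  by rewrite expn0 ltnS leqn0 => /eqP ->.
move=> fK nextQ w; have [] := IH (fun a => (f a)./2)
  (fun m => next (odd (f (x i)) + m.*2)) _ _ w.
- by rewrite ltn_half_double -mul2n -expnS.
- by rewrite odd_double_half.
- by split.
Qed.

Variable T : finType.

Definition width := (trunc_log 2 #|{: option T}|).+1.

Definition write_option (i : 'I_s) (f : X -> option T) (next : option T -> protocol) :=
  write_nat width i (fun a => enum_rank (f a))
    (fun m => next (nth None (enum {: option T}) m)).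

Lemma achieves_write_option i f next x Q c :
  achieves (next (f (x i))) x Q c ->
  achieves (write_option i f next) x Q (width + c).
Proof.
move=> nextQ; apply: achieves_write_nat; last by rewrite nth_enum_rank.
by rewrite (leq_trans (ltn_ord _))// ltnW// trunc_log_ltn.
Qed.

End Messages.

(** * Polling the sites at amortized cost *)

Section Sweep.
Variables (s n r : nat).
Local Notation protocol := (protocol s (edges n) (edges n) (r.-tuple bool)).
Local Notation pair := ('I_n * 'I_n)%type.
Implicit Types (H : edges n) (next : edges n -> protocol).

Variable wanted : edges n -> rel 'I_n.

(* Site [i] announces wanted edges, adding them to the board [H], until it has
   none left; the fuel only makes the recursion structural. *)
Fixpoint announce (fuel : nat) (i : 'I_s) H next : protocol :=
  if fuel is fuel'.+1 then
    write_option i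
      (fun E => [pick p : pair | adj E p.1 p.2 && wanted H p.1 p.2])
      (fun o => if o is Some p then announce fuel' i ([set p.1; p.2] |: H) next
                else next H)
  else next H.

Fixpoint sweep (fuel : nat) (sites : seq 'I_s) H next : protocol :=
  if sites is i :: sites' then
    announce fuel i H (fun H' => sweep fuel sites' H' next)
  else next H.

Variables (x : {ffun 'I_s -> edges n}) (G H0 : edges n) (progress : edges n -> nat).
Variables (bound fuel : nat) (Q : edges n -> Prop) (c : nat).
Hypotheses
  (xG : forall i, x i \subset G)
  (wanted_sub : forall H H' u v, H \subset H' -> wanted H' u v -> wanted H u v)
  (wanted_progress : forall H u v, H0 \subset H -> H \subset G -> adj G u v ->
     wanted H u v -> progress H < progress ([set u; v] |: H))
  (progress_bound : forall H, H \subset G -> progress H <= bound)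
  (bound_fuel : bound < fuel).

Local Notation K := (width pair).

(** Each edge announced costs [K] and lowers [bound - progress H] by at least one; the leading [K]
    pays for the closing [None]. The fuel exceeds the remaining potential, so it never runs out. *)
Lemma achieves_announce f i H next e :
  H0 \subset H -> H \subset G -> bound - progress H < f ->
  (forall H', H \subset H' -> H' \subset G ->
     (forall u v, adj (x i) u v -> ~~ wanted H' u v) ->
     achieves (next H') x Q (e + K * (bound - progress H'))) ->
  achieves (announce f i H next) x Q (K + e + K * (bound - progress H)).
Proof.
elim: f H => // f IH H sH0H sHG lt_f nextQ /=.
rewrite -addnA; apply: achieves_write_option; case: pickP => [[u v]|none] /=.
  move=> /andP[xuv Huv]; set H' := _ |: H.
  have Guv : adj G u v by apply: adj_sub xuv.
  have sHH' : H \subset H' by apply: subsetUr.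
  have sH'G : H' \subset G by rewrite subUset sub1set; apply/andP.
  have lt_progress := wanted_progress sH0H sHG Guv Huv.
  rewrite -/H' in lt_progress; have := progress_bound sH'G => H'b.
  apply: achieves_leq (IH _ _ sH'G _ _).
  - rewrite addnAC addnC leq_add2l.
    by rewrite -mulnS leq_mul2l; apply/orP; right; lia.
  - exact: fintype.subset_trans sHH'.
  - by lia.
  - by move=> H'' sH'H''; apply: nextQ; apply: fintype.subset_trans sH'H''.
by apply: nextQ => // u v xuv; have := none (u, v); rewrite xuv/= => ->.
Qed.

(** One pass suffices: by [wanted_sub], sites polled earlier want nothing new as the board grows. *)
Lemma achieves_sweep sites H next :
  H0 \subset H -> H \subset G ->
  (forall H', H \subset H' -> H' \subset G ->
     (forall i u v, i \in sites -> adj (x i) u v -> ~~ wanted H' u v) ->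
     achieves (next H') x Q (c + K * (bound - progress H'))) ->
  achieves (sweep fuel sites H next) x Q
    (K * size sites + c + K * (bound - progress H)).
Proof.
elim: sites H => [|i sites IH] H sH0H sHG nextQ /=; first by rewrite muln0; apply: nextQ.
rewrite mulnS -(addnA K); apply: achieves_announce => //.
  by rewrite (leq_ltn_trans (leq_subr _ _)).
move=> H' sHH' sH'G quiet; apply: IH => //.
  exact: fintype.subset_trans sHH'.
move=> H'' sH'H'' sH''G quiet'; apply: nextQ => //.
  exact: fintype.subset_trans sH'H''.
move=> j u v; rewrite inE => /predU1P[->|]; last exact: quiet'.
by move=> /quiet; apply: contraNN; apply: wanted_sub.
Qed.

End Sweep.

(** * The protocol and its correctness *)

Section SpannerProtocol.
Variables (n s r d : nat).
Local Notation protocol := (protocol s (edges n) (edges n) (r.-tuple bool)).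
Implicit Types (H G : edges n) (Z C : {set 'I_n}).

Definition degree H v := #|[set y | adj H v y]|.

Lemma degree_sub H G v : H \subset G -> degree H v <= degree G v.
Proof.
by move=> sHG; apply/subset_leq_card/subsetP => y; rewrite !inE; apply: adj_sub.
Qed.

(** Testing one endpoint is enough, since [announce] looks at both orientations of an edge. *)
Definition sparse_missing H u v := ~~ adj H u v && (degree H u < d).

Lemma sparse_missing_sub H H' u v :
  H \subset H' -> sparse_missing H' u v -> sparse_missing H u v.
Proof.
move=> sHH' /andP[uv ud]; rewrite /sparse_missing (leq_ltn_trans _ ud) ?degree_sub//.
by rewrite andbT; apply: contraNN uv; apply: adj_sub.
Qed.

(** The potential of the first phase: the cap bounds it by [n * d], yet it grows with every edge
    written, one endpoint being below the cap. *)
Definition capped_degrees H := \sum_v minn (degree H v) d.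

Lemma capped_degrees_bound H : capped_degrees H <= n * d.
Proof.
rewrite -[n in n * d]card_ord -sum_nat_const.
by apply: leq_sum => v _; apply: geq_minr.
Qed.

Lemma sparse_missing_progress H u v : sparse_missing H u v ->
  capped_degrees H < capped_degrees ([set u; v] |: H).
Proof.
move=> /andP[uv ud]; set H' := _ |: H; have sHH' : H \subset H' by apply: subsetUr.
rewrite /capped_degrees (bigD1 u)// [ltnRHS](bigD1 u)//= -addSn leq_add//.
  suff : degree H u < degree H' u by lia.
  apply/proper_card/properP; split.
    by apply/subsetP => y; rewrite !inE; apply: adj_sub.
  by exists v; rewrite inE// /adj setU11.
by apply: leq_sum => w _; have := degree_sub w sHH'; lia.
Qed.

Definition crowded H := [set v | d <= degree H v].

(** The product [q * L] of [hitting_set], with [n <= q * d] and [n < 2 ^ L]. *)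
Definition centers_bound := (n %/ d).+1 * (trunc_log 2 n).+1.

Definition dominates C H :=
  [forall z in crowded H, ~~ [disjoint [set y | adj H z y] & C]].

(** A function of the board, so all parties agree on the centers without communicating. *)
Definition centers H : {set 'I_n} :=
  odflt set0 [pick C : {set 'I_n} | (#|C| <= centers_bound) && dominates C H].

Hypothesis d_gt0 : 0 < d.

Lemma centersP H : #|centers H| <= centers_bound /\ dominates (centers H) H.
Proof.
rewrite /centers; case: pickP => [C /andP[]//|] none /=.
have [|||C [CB hC]] := @hitting_set 'I_n 'I_n (fun z => [set y | adj H z y])
  (crowded H) d d_gt0 _ (n %/ d).+1 (trunc_log 2 n).+1.
- by move=> z; rewrite inE.
- by rewrite card_ord ltnW// ltn_ceil.
- by rewrite (leq_ltn_trans (max_card _))// card_ord trunc_log_ltn.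
have := none C; rewrite CB /= => /negP[].
by apply/forall_inP.
Qed.

Fixpoint search (fuel : nat) Z C (rounds t : nat) H : protocol :=
  if rounds is rounds'.+1 then
    sweep (requested Z C t H) fuel (enum 'I_s) H (search fuel Z C rounds' t.+1)
  else Output _ _ (fun _ => H).

(** Exceeds the potentials of both phases. *)
Definition fuel := (n * d + n * n).+1.

Definition spanner_protocol : protocol :=
  sweep sparse_missing fuel (enum 'I_s) set0 (fun H =>
    search fuel (crowded H) (centers H) (3 * n %/ d) 0 H).

Local Notation K := (width ('I_n * 'I_n)%type).

Section Correctness.
Variable x : {ffun 'I_s -> edges n}.
Let G := \bigcup_(i < s) x i.

Let xG i : x i \subset G.
Proof. exact: (finset.bigcup_sup i). Qed.

Let G_adj (P : Prop) u v : adj G u v -> (forall i, adj (x i) u v -> P) -> P.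
Proof. by move=> /bigcupP[i _ uv] /(_ i uv). Qed.

Lemma achieves_search Z C H1 rounds t H :
  (forall u v, adj G u v -> u \notin Z -> adj H1 u v) ->
  H1 \subset H -> H \subset G -> exact_within Z C G t H ->
  achieves (search fuel Z C rounds t H) x
    (fun H' => [/\ H1 \subset H', H' \subset G & exact_within Z C G (t + rounds) H'])
    (K * (s * rounds) + K * (#|C| * n - #|exact_pairs C G H|)).
Proof.
move=> known; elim: rounds t H => [|rounds IH] t H sH1H sHG exH.
  by move=> w; split => //=; rewrite addn0.
rewrite [search _ _ _ _ _ _]/= mulnS mulnDr -[s in K * s + _](size_enum_ord).
apply: (achieves_sweep (G := G) (H0 := H)
  (progress := fun H' => #|exact_pairs C G H'|)) => //.
- by move=> H' H'' u v; apply: requested_sub.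
- by move=> H' u v sHH' sH'G uv; apply: requested_progress.
- move=> H' _; rewrite -[n in _ * n]card_ord -cardsT -cardsX.
  by apply/subset_leq_card/subsetP => -[a b]; rewrite !inE => /andP[-> _].
- rewrite ltnS (leq_trans _ (leq_addl _ _))// leq_mul2r.
  by rewrite -[X in _ <= X]card_ord max_card orbT.
move=> H' sHH' sH'G quiet; rewrite addnS -addSn; apply: IH => //.
  exact: fintype.subset_trans sHH'.
apply: (exact_step known sH1H sHG exH) => // u v uv; apply: (G_adj uv) => i.
by apply: quiet; rewrite mem_enum.
Qed.

Lemma spanner_protocol_correct (R : realType) k : 2 <= k ->
  achieves spanner_protocol x (is_spanner R k G)
    (K * (s + n * d + s * (3 * n %/ d) + n * centers_bound)).
Proof.
move=> k2; set T := 3 * n %/ d.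
apply: (@achieves_leq _ _ _ _ _ _ _ (K * size (enum 'I_s) +
  (K * (s * T) + K * (n * centers_bound)) + K * (n * d - capped_degrees set0))).
  by rewrite size_enum_ord; nia.
apply: (@achieves_sweep _ _ _ _ _ G set0) => //.
- exact: sparse_missing_sub.
- by move=> H u v _ _ _; apply: sparse_missing_progress.
- by move=> H _; apply: capped_degrees_bound.
- by rewrite ltnS leq_addr.
- exact: sub0set.
(* The unspent potential of the first phase is given away. *)
move=> H _ sHG quiet; apply: achieves_leq (leq_addr _ _) _.
have [CB domC] := centersP H; set Z := crowded H; set C := centers H.
have known u v : adj G u v -> u \notin Z -> adj H u v.
  move=> uv; rewrite inE -ltnNge => ud; apply: (G_adj uv) => i iuv.
  have := quiet i u v; rewrite mem_enum => /(_ isT iuv).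
  by rewrite /sparse_missing ud andbT negbK.
have exH : exact_within Z C G 0 H by apply: exact0 known sHG.
move=> w; have [] := achieves_search T known (fintype.subxx H) sHG exH w.
move=> [sHH' H'G exH'] cost; split; last first.
  rewrite (leq_trans cost)// leq_add2l leq_mul2l [n * _]mulnC; apply/orP; right.
  by rewrite (leq_trans (leq_subr _ _))// leq_mul2r CB orbT.
apply: (@spanner_of_centers _ _ _ Z C) => //.
- by move=> u v uv uZ; apply: adj_sub sHH' (known u v uv uZ).
- move=> z zZ; have /forall_inP/(_ z zZ) := domC.
  rewrite -setI_eq0 => /set0Pn[c]; rewrite !inE => /andP[zc cC].
  by exists c => //; apply: adj_sub zc.
(* No rank exceeds the number of rounds, so every distance from a center is exact. *)
- move=> c v cC; apply: exH' => //; rewrite add0n leq_divRL//.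
  apply: rank_bound => z; rewrite inE => /leq_trans; apply.
  exact: degree_sub.
Qed.

End Correctness.
End SpannerProtocol.

Local Open Scope ring_scope.

(** * Estimating the cost *)

Section Bound.
Variable R : realType.

(** From [expR (- 2^-1) >= 1 - 2^-1]. *)
Lemma ln2_ge_half : 2^-1 <= ln 2 :> R.
Proof.
rewrite -ler_expR lnK ?posrE//.
rewrite -[leLHS]invrK -expRN -[leRHS]invrK lef_pV2 ?posrE ?expR_gt0//.
by apply: le_trans (expR_ge1Dx _); lra.
Qed.

Lemma trunc_log2_le_ln m : (trunc_log 2 m)%:R <= 2 * ln m%:R :> R.
Proof.
have [->|m_gt0] := posnP m; first by rewrite trunc_log0 ln0// mulr0.
have : 2%:R ^+ trunc_log 2 m <= m%:R :> R by rewrite -natrX ler_nat trunc_logP.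
rewrite -ler_ln ?posrE ?exprn_gt0 ?ltr0n// lnXn ?ltr0n// -(mulr_natr (ln 2)).
set t := (trunc_log 2 m)%:R => le_ln.
have : 2^-1 * t <= ln 2 * t by rewrite ler_wpM2r ?ln2_ge_half.
lra.
Qed.

(** The choice of [d] close to [r] balances [n * d] against [s * n / d] and [n * n / d]. The
    constant is [6 * 28]: 6 from the message width, 28 from the number of messages. *)
Lemma cost_bound n s d (r := Num.sqrt (n + s)%N%:R : R) :
  (0 < d)%N -> r <= d%:R -> d%:R <= r + 1 ->
  (width ('I_n * 'I_n)%type *
     (s + n * d + s * (3 * n %/ d) + n * centers_bound n d))%N%:R <=
  168 * (s%:R + n%:R * r) * ln (n + s + 2)%N%:R ^+ 2.
Proof.
move=> d_gt0 rd dr; set N := (n + s + 2)%N; set l := ln N%:R : R.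
have d_gt0R : 0 < d%:R :> R by rewrite ltr0n.
have r2 : r ^+ 2 = n%:R + s%:R by rewrite sqr_sqrtr// natrD.
have r_ge0 : 0 <= r := sqrtr_ge0 _.
have n_ge0 : 0 <= n%:R :> R by []. have s_ge0 : 0 <= s%:R :> R by [].
have nr : n%:R <= n%:R * r.
  have [->|n_gt0] := posnP n; first by rewrite mul0r.
  by rewrite ler_peMr// -[leLHS]sqrtr1 ler_sqrt// ler1n addn_gt0 n_gt0.
have lnN m a : (0 < m)%N -> (m <= N ^ a)%N -> ln m%:R <= a%:R * l.
  move=> m_gt0 mN; rewrite mulr_natl -lnXn ?ltr0n /N ?addn2// -natrX.
  by rewrite ler_ln ?posrE ?ltr0n ?expn_gt0 ?addn2// ler_nat -addn2.
(* This lets [2 * l] absorb each additive 1 below. *)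
have l_half : 2^-1 <= l.
  rewrite (le_trans ln2_ge_half)// ler_ln ?posrE ?ltr0n /N ?addn2//.
  by rewrite (ler_nat R 2).
have L_le : (trunc_log 2 n).+1%:R <= 4 * l.
  rewrite -natr1; have := trunc_log2_le_ln n.
  have [->|n_gt0] := posnP n; first by rewrite trunc_log0; lra.
  by have := @lnN n 1 n_gt0; rewrite /N expn1 -addnA leq_addr => /(_ isT); lra.
have K_le : (width ('I_n * 'I_n)%type)%:R <= 6 * l.
  rewrite /width card_option card_prod card_ord -natr1.
  have := trunc_log2_le_ln (n * n).+1; have := @lnN (n * n).+1 2 isT.
  by rewrite expnS expn1 => /(_ ltac:(rewrite /N; nia)); lra.
(* Because [s <= r ^+ 2 <= r * d]; the next bound uses [n <= r * d] in the same way. *)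
have T_le : s%:R * (3 * n %/ d)%:R <= 3 * (n%:R * r).
  have : (3 * n %/ d)%:R * d%:R <= 3 * n%:R :> R.
    by rewrite -!natrM ler_nat leq_trunc_div.
  set T := _%:R; have : 0 <= T :> R by []; nra.
have q_le : n%:R * (n %/ d).+1%:R <= 2 * (n%:R * r).
  have : (n %/ d)%:R * d%:R <= n%:R :> R by rewrite -natrM ler_nat leq_trunc_div.
  rewrite -natr1; set q := _%:R; have : 0 <= q :> R by []; nra.
have nr_ge0 : 0 <= n%:R * r by rewrite mulr_ge0.
have nd_le : n%:R * d%:R <= 2 * (n%:R * r) by nra.
have qL_le : n%:R * ((n %/ d).+1%:R * (trunc_log 2 n).+1%:R) <=
    2 * (n%:R * r) * (4 * l).
  by rewrite mulrA ler_pM// mulr_ge0.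
rewrite /centers_bound natrM !natrD !(natrM _ n) !(natrM _ s) natrM.
set M := (X in _ * X); suff M_le : M <= 28 * l * (s%:R + n%:R * r).
  rewrite (le_trans (ler_pM _ _ K_le M_le))//; first by rewrite !addr_ge0 ?mulr_ge0.
  by rewrite le_eqVlt; apply/orP; left; apply/eqP; ring.
rewrite /M; have : s%:R <= 2 * l * s%:R by nra.
have : n%:R * r <= 2 * l * (n%:R * r) by nra.
have : 0 <= l * s%:R by rewrite mulr_ge0//; lra.
have : 0 <= l * (n%:R * r) by rewrite mulr_ge0//; lra.
lra.
Qed.

End Bound.

(** * From the cost of the protocol to the communication complexity *)

Local Open Scope classical_set_scope.

Theorem theorem13 (R : realType) (k : nat) (hk : (2 <= k)%N) (dup : bool) :
  exists eps : nat -> R,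
    eps @ \oo --> (0 : R) /\
    soft_O (fun n s : nat => spanner_complexity k dup (eps (n + s)%N) n s)
      (fun n s : nat => s%:R + n%:R * Num.sqrt (n + s)%N%:R).
Proof.
(* The protocol never errs. *)
exists (fun=> 0); split; first exact: cvg_cst.
exists 168, 2%N => n s; set r := Num.sqrt _.
have r_ge0 : 0 <= r := sqrtr_ge0 _.
(* The successor keeps [d] positive and at least [r], even for [n + s = 0]. *)
pose d := (Num.truncn r).+1; pose p := spanner_protocol n s 0 d.
have correct (x : {ffun 'I_s -> edges n}) := spanner_protocol_correct (r := 0) (ltn0Sn _ : (0 < d)%N) x R hk.
apply: (@le_trans _ _ (cost (@distributed_graph dup n s) p)%:R%:E).
  apply: ereal_inf_lbound; exists 0%N, p; split => // x _.
  rewrite subr0 /success_prob.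
  rewrite (_ : [set w | _]%SET = [set: coins s 0]%SET).
    by rewrite cardsT divff// pnatr_eq0 -lt0n; apply/card_gt0P; exists [ffun=> [tuple]].
  by apply/setP => w; rewrite !inE; apply/asboolP; have [] := correct x w.
rewrite lee_fin; have := @cost_bound R n s d isT.
have := truncn_itv r_ge0; rewrite -/r => /andP[le_r r_lt].
move=> /(_ (ltW r_lt)) bound; apply: le_trans (bound _); last first.
  by rewrite /d -natr1 lerD2r.
rewrite ler_nat; apply/bigmax_leqP => x _; apply/bigmax_leqP => w _.
by have [] := correct x w.
Qed.
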